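(* Let $t\ge 1$ and let $T=(T_+,T_-)$ be a simple $[t]$-trade with $1.5\cdot 2^t<\mathrm{vol}(T)<2.5\cdot 2^t$ and $\mathrm{vol}(T)\neq 2^{t+1}$. Then $\mathrm{afrk}(T)\ge t+4$.
   Context: Let $V=\{1,\dots,v\}$. Subsets of $V$ are identified with their characteristic vectors in $\mathrm{GF}(2)^v$, so $2^V$ is a $v$-dimensional vector space over $\mathrm{GF}(2)$ whose addition is symmetric difference. A $[t]$-trade is a pair $T=(T_+,T_-)$ of disjoint finite multisets of subsets of $V$ (called blocks) such that for every $i\in\{0,1,\dots,t\}$, every $i$-subset of $V$ is contained in the same number of blocks of $T_+$ as of $T_-$ (counting multiplicity). It is simple if no block is repeated. Its volume is $\mathrm{vol}(T)=|T_+|=|T_-|$. For a simple $[t]$-trade, $\mathrm{afrk}(T)$ denotes the dimension of the affine span of $T_+\cup T_-$ in $\mathrm{GF}(2)^v$. *)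

(* Defs.v *)
From mathcomp Require Import all_boot all_order all_algebra.
From mathcomp Require Import finmap multiset.

Set Implicit Arguments.
Unset Strict Implicit.
Unset Printing Implicit Defensive.

Import GRing.Theory.
Local Open Scope nat_scope.

(* The ground set {1, ..., v} is represented by 'I_v = {0, ..., v-1}. *)
Notation block v := {set 'I_v}.

Notation mset_pair v := ({mset block v}%mset * {mset block v}%mset)%type.

(* A multiset coerces to the sequence listing its elements with multiplicity,
   so [count] and [size] below count multiplicities. *)
Definition is_trade (t v : nat) (T : mset_pair v) : Prop :=
  [disjoint T.1 & T.2] /\
  forall (i : nat) (I : {set 'I_v}), i <= t -> #|I| = i ->
    count (fun B : block v => I \subset B) T.1 =
    count (fun B : block v => I \subset B) T.2.

Definition is_simple (v : nat) (T : mset_pair v) : Prop :=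
  forall B : block v, T.1 B <= 1 /\ T.2 B <= 1.

(* For a trade this is also [size T.2], by the balance condition for i = 0. *)
Definition vol (v : nat) (T : mset_pair v) : nat := size T.1.

Definition charv (v : nat) (B : block v) : 'rV['F_2]_v :=
  (\row_(j < v) (j \in B)%:R)%R.

Definition affine_span (v : nat) (S : {set 'rV['F_2]_v}) :
    {set 'rV['F_2]_v} :=
  [set (\sum_(x in S) c x *: x)%R
     | c : {ffun 'rV['F_2]_v -> 'F_2} & (\sum_(x in S) c x == 1)%R].

(* The dimension of an affine subspace is that of its direction space;
   for the empty set this gives 0. *)
Definition affine_dim (v : nat) (A : {set 'rV['F_2]_v}) : nat :=
  \dim <<[seq (x - y)%R | x <- enum A, y <- enum A]>>%VS.

Definition afrk (v : nat) (T : mset_pair v) : nat :=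
  affine_dim (affine_span
    [set charv B | B : block v & (B \in T.1) || (B \in T.2)]).

(* Main.v *)
(* Let F = T_+ - T_-, and suppose afrk(T) <= t + 3. Then some set J of at most
   t + 3 coordinates separates the blocks, and F pushes forward along
   B |-> B :&: J to an integer function f with the same sum of squares, namely
   2 vol(T). The sums a(I) of f over the supersets of I vanish unless I is
   included in J and |I| > t. Moebius inversion turns the sum of f^2 into the
   quadratic form with terms a(I) a(I') 2^|I :&: I'| up to sign. Its diagonal
   terms are divisible by 2^(t+1); its off-diagonal ones come in equal pairs
   and satisfy |I :&: I'| >= 2(t+1) - (t+3) = t - 1. Hence 2^t divides
   2 vol(T), and the volume bounds leave only vol(T) = 2^(t+1). *)
From mathcomp Require Import zify lra.
Require Import Defs.
From mathcomp Require Import all_boot all_order all_algebra.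
From mathcomp Require Import finmap multiset.
Import GRing.Theory Num.Theory.
Local Open Scope nat_scope.

(** Induction splits off the row and the column of the head [a]. They share the diagonal term, and
    by symmetry their other terms pair up to twice [w a y]. *)
Lemma dvdz_symmetric_sum (d : int) (I : Type) (r : seq I) (w : I -> I -> int) :
    (forall x y, w x y = w y x) ->
    (forall x, (d %| w x x)%Z) -> (forall x y, (d %| (w x y *+ 2)%R)%Z) ->
  (d %| (\sum_(x <- r) \sum_(y <- r) w x y)%R)%Z.
Proof.
move=> wC dw dw2; elim: r => [|a r IHr]; first by rewrite big_nil dvdz0.
rewrite big_cons big_cons.
under [X in (_ + X)%R]eq_bigr => x _ do rewrite big_cons.
rewrite big_split /= -addrA addrA -[(_ + _ + _)%R]addrA rpredD ?dw //.
rewrite addrA -big_split rpredD //; apply: rpred_sum => y _ /=.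
by rewrite [w y a]wC -mulr2n.
Qed.

Section Moebius.

Variable T : finType.
Implicit Types (I J K L : {set T}) (f : {set T} -> int).

Lemma sum_interval_sign K L :
  (\sum_(I : {set T} | (K \subset I) && (I \subset L))
     (-1) ^+ #|I| = (-1) ^+ #|K| *+ (K == L) :> int)%R.
Proof.
(* [F i] is the weight of putting [i] into [I] and [G i] that of leaving it out; each is 0 when the
   choice violates [K \subset I] or [I \subset L]. A point of [L] outside [K] gives the factor -1 +
   1 = 0. *)
pose F i : int := (- (i \in L)%:R)%R; pose G i : int := (i \notin K)%:R%R.
have -> : (\sum_(I : {set T} | (K \subset I) && (I \subset L)) (-1) ^+ #|I|
           = \prod_i (F i + G i) :> int)%R.
  rewrite bigA_distr big_mkcond; apply: eq_bigr => I _.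
  have [/subsetP KI|/subsetPn[x xK xI]] := boolP (K \subset I); last first.
    by rewrite (bigD1 x) //= (negPf xI) /G xK mul0r.
  have [/subsetP IL|/subsetPn[x xI xL]] := boolP (I \subset L); last first.
    by rewrite (bigD1 x) //= xI /F (negPf xL) oppr0 mul0r.
  rewrite -prodr_const [LHS]big_mkcond; apply: eq_bigr => i _.
  case: ifP => iI; first by rewrite /F (IL _ iI).
  by rewrite /G; case: (boolP (i \in K)) => // /KI; rewrite iI.
have [eqKL|neqKL] := eqVneq K L.
  rewrite -prodr_const [RHS]big_mkcond; apply: eq_bigr => i _.
  by rewrite /F /G -eqKL; case: (i \in K).
have [/subsetP KL|/subsetPn[x xK xL]] := boolP (K \subset L); last first.
  by rewrite (bigD1 x) //= /F /G xK (negPf xL) oppr0 addr0 mul0r.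
have /subsetPn[x xL xK] : ~~ (L \subset K).
  by apply: contra neqKL => LK; rewrite eqEsubset LK andbT; apply/subsetP.
by rewrite (bigD1 x) //= /F /G xK xL addNr mul0r.
Qed.

Definition upsum f I : int := (\sum_(K : {set T} | I \subset K) f K)%R.

(** After exchanging the sums, the coefficient of [f L] is a signed sum over the interval from [K]
    to [L], which vanishes unless [L = K]. *)
Lemma upsum_inversion f K :
  (f K = \sum_(I : {set T} | K \subset I) (-1) ^+ (#|K| + #|I|) * upsum f I)%R.
Proof.
under eq_bigr => I _ do rewrite exprD -mulrA mulr_sumr.
rewrite -mulr_sumr (exchange_big_dep predT) //=.
under eq_bigr => L _ do rewrite -mulr_suml sum_interval_sign.
rewrite (bigD1 K) //= eqxx big1 ?addr0.
  by rewrite mulrA -exprD addnn -mul2n exprM sqrrN expr1n mul1r.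
by move=> L; rewrite eq_sym => /negPf ->; rewrite mul0r.
Qed.

(** Both factors of [f K ^+ 2] are inverted. The two signs of [K] cancel, and exactly
    [2 ^ #|I :&: J|] sets [K] lie below both [I] and [J]. *)
Lemma sum_sqr_upsum f :
  (\sum_(K : {set T}) f K ^+ 2 = \sum_(I : {set T}) \sum_(J : {set T})
     (-1) ^+ (#|I| + #|J|) * upsum f I * upsum f J *+ 2 ^ #|I :&: J|)%R.
Proof.
transitivity (\sum_(K : {set T}) \sum_(I : {set T}) \sum_(J : {set T})
   if K \subset I :&: J then
     (-1) ^+ (#|I| + #|J|) * upsum f I * upsum f J else 0)%R.
  apply: eq_bigr => K _; rewrite expr2 [in LHS]upsum_inversion big_distrlr /=.
  rewrite big_mkcond; apply: eq_bigr => I _.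
  case: ifP => KI; last by rewrite big1 // => J _; rewrite subsetI KI.
  rewrite big_mkcond; apply: eq_bigr => J _; rewrite subsetI KI /=.
  case: ifP => // _; rewrite mulrACA -exprD addnACA addnn exprD mulrA.
  by rewrite -mul2n exprM sqrrN expr1n mul1r.
rewrite exchange_big; apply: eq_bigr => I _.
rewrite exchange_big; apply: eq_bigr => J _.
rewrite -big_mkcond sumr_const; congr (_ *+ _)%R.
by rewrite -card_powerset; apply: eq_card => K; rewrite !inE.
Qed.

Lemma dvdz_sum_sqr f J t :
    0 < t -> #|J| <= t + 3 ->
    (forall I, upsum f I != 0%R -> (I \subset J) && (t < #|I|)) ->
  ((2 ^ t)%N %| (\sum_(K : {set T}) f K ^+ 2)%R)%Z.
Proof.
move=> t_gt0 leJ supp_f; rewrite sum_sqr_upsum.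
have dvd2 m n (x : int) : m <= n -> ((2 ^ m)%N %| (x *+ 2 ^ n)%R)%Z.
  by move=> le_mn; rewrite -mulr_natr natz dvdz_mull // dvdzE /= dvdn_exp2l.
apply: dvdz_symmetric_sum => [I I'|I|I I'].
- by rewrite setIC addnC mulrAC.
- have [->|/supp_f/andP[_ ltI]] := eqVneq (upsum f I) 0%R.
    by rewrite mulr0 mul0rn dvdz0.
  by rewrite setIid dvd2 // ltnW.
have [->|/supp_f/andP[IJ ltI]] := eqVneq (upsum f I) 0%R.
  by rewrite mulr0 mul0r !mul0rn dvdz0.
have [->|/supp_f/andP[I'J ltI']] := eqVneq (upsum f I') 0%R.
  by rewrite mulr0 !mul0rn dvdz0.
(* The doubling raises the exponent by one, so [t <= #|I :&: I'| + 1] suffices. *)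
rewrite -mulrnA -expnSr dvd2 //.
have := cardsUI I I'; have : #|I :|: I'| <= #|J|.
  by apply: subset_leq_card; rewrite subUset IJ.
lia.
Qed.

(** The right-hand sum is empty when [I] is not inside [J], and is the superset sum of [F] itself
    when it is. *)
Lemma upsum_trace (F : {set T} -> int) J I :
  upsum (fun K => \sum_(B : {set T} | B :&: J == K) F B)%R I =
  (\sum_(B : {set T} | I \subset B :&: J) F B)%R.
Proof.
rewrite /upsum (exchange_big_dep (fun B => I \subset B :&: J)) /=; last first.
  by move=> K B IK /eqP ->.
by apply: eq_bigr => B IB; rewrite (big_pred1 (B :&: J)) // => K /=;
   rewrite eq_sym; case: eqP => [->|]; rewrite ?andbF // IB.
Qed.

(** Each fibre of the trace on [J] meets the support of [F] at most once, so all cross terms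
    vanish. *)
Lemma sum_sqr_trace (F : {set T} -> int) J :
    (forall B B', F B != 0%R -> F B' != 0%R -> B :&: J = B' :&: J -> B = B') ->
  (\sum_(K : {set T}) (\sum_(B : {set T} | B :&: J == K) F B) ^+ 2
     = \sum_(B : {set T}) F B ^+ 2)%R.
Proof.
move=> injF; rewrite [RHS](partition_big (fun B => B :&: J) predT) //=.
apply: eq_bigr => K _; rewrite expr2 big_distrlr /=.
apply: eq_bigr => B BK; rewrite (bigD1 B) //= big1 ?addr0 ?expr2 //.
move=> B' /andP[B'K neqB]; apply/eqP; rewrite mulf_eq0; apply: contraR neqB.
rewrite negb_or => /andP[FB FB']; apply/eqP/injF => //.
by rewrite (eqP BK) (eqP B'K).
Qed.

End Moebius.

(** If some vector of [D] has a nonzero [j]-th coordinate, cutting [D] by the hyperplane where that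
    coordinate is 0 lowers the dimension; induct and add [j] to the set found. *)
Lemma separating_coordinates (K : fieldType) (v n : nat)
    (D : {vspace 'rV[K]_v}) :
    \dim D <= n ->
  exists2 J : {set 'I_v}, #|J| <= n &
    forall d, d \in D -> (forall j, j \in J -> d 0%R j = 0%R) -> d = 0%R.
Proof.
elim: n D => [|n IHn] D leDn.
  exists set0; rewrite ?cards0 // => d dD _.
  by move: leDn dD; rewrite leqn0 dimv_eq0 => /eqP ->; rewrite memv0 => /eqP.
have [->|Dn0] := eqVneq D 0%VS.
  by exists set0 => [|d]; rewrite ?cards0 // memv0 => /eqP.
have /rV0Pn[j dj] : vpick D != 0%R by rewrite vpick0.
pose p : 'Hom('rV[K]_v, 'M[K]_1) := linfun (col j).
have pE e : (e \in lker p) = (e 0%R j == 0%R).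
  rewrite memv_ker lfunE /=; apply/eqP/eqP => [/matrixP/(_ 0%R 0%R)|e0].
    by rewrite !mxE.
  by apply/matrixP => a b; rewrite !mxE !ord1.
have [J leJ sepJ] : exists2 J : {set 'I_v}, #|J| <= n &
    forall e, e \in (D :&: lker p)%VS ->
      (forall i, i \in J -> e 0%R i = 0%R) -> e = 0%R.
  apply: IHn; rewrite -ltnS; apply: leq_trans leDn.
  rewrite (ltn_leqif (dimv_leqif_sup (capvSl D (lker p)))).
  apply: contra dj => /subvP/(_ _ (memv_pick D)).
  by rewrite memv_cap pE => /andP[].
exists (j |: J) => [|e eD e0].
  by rewrite cardsU1 -add1n leq_add // leq_b1.
apply: sepJ => [|i iJ]; last by rewrite e0 // setU1r.
by rewrite memv_cap eD pE e0 ?setU11 /=.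
Qed.

Lemma count_mset (K : finType) (p : pred K) (A : {mset K}%mset) :
  count p A = \sum_(x | p x) A x.
Proof.
under eq_bigr => x _ do rewrite -count_mem_mset.
elim: {A}(A : seq K) => [|a s IHs] /=; first by rewrite big1.
rewrite big_split -IHs /=; congr (_ + _).
rewrite -big_mkcondr (eq_bigl (fun x => (x == a) && p x)) /=.
  case pa: (p a).
    by rewrite (big_pred1 a) // => x /=; case: eqVneq => // ->.
  by rewrite big_pred0 // => x; case: eqVneq => // ->.
by move=> x; rewrite andbC eq_sym.
Qed.

Lemma subset_affine_span (v : nat) (S : {set 'rV['F_2]_v}) :
  S \subset affine_span S.
Proof.
apply/subsetP => y yS; apply/imsetP; exists [ffun x => (x == y)%:R]%R.
  rewrite inE (bigD1 y) //= ffunE eqxx big1 ?addr0 //.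
  by move=> x /andP[_ /negPf]; rewrite ffunE => ->.
rewrite (bigD1 y) //= ffunE eqxx scale1r big1 ?addr0 //.
by move=> x /andP[_ /negPf]; rewrite ffunE => ->; rewrite scale0r.
Qed.

Lemma separating_blocks (v n : nat) (T : mset_pair v) :
    afrk T <= n ->
  exists2 J : {set 'I_v}, #|J| <= n &
    forall B B' : block v, (B \in T.1) || (B \in T.2) ->
      (B' \in T.1) || (B' \in T.2) -> B :&: J = B' :&: J -> B = B'.
Proof.
move=> /separating_coordinates[J leJ sepJ]; exists J => // B B' TB TB' eqJ.
suff /rowP eqB : charv B = charv B'.
  apply/setP => j; have := eqB j; rewrite !mxE.
  by case: (j \in B); case: (j \in B').
(* The difference of the two characteristic vectors lies in the direction space, and equal traces
   make it vanish on [J]. *)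
apply/eqP; rewrite -subr_eq0; apply/eqP/sepJ => [|j jJ].
  apply/memv_span/allpairsP; exists (charv B, charv B').
  by split=> //=; rewrite mem_enum (subsetP (subset_affine_span _ _)) // imset_f
       ?inE.
have /setP/(_ j) := eqJ; rewrite !inE jJ !andbT => eqj.
by rewrite !mxE eqj subrr.
Qed.

Lemma dvdn_vol (v t : nat) (T : mset_pair v) :
    0 < t -> is_trade t T -> is_simple T -> afrk T <= t + 3 ->
  2 ^ t %| 2 * vol T.
Proof.
move=> t_gt0 [disjT balT] simT /separating_blocks[J leJ sepJ].
pose F (B : block v) : int := ((T.1 B)%:Z - (T.2 B)%:Z)%R.
have suppF B : F B != 0%R -> (B \in T.1) || (B \in T.2).
  rewrite !in_mset /F; lia.
have sumF (I : {set 'I_v}) : #|I| <= t ->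
    (\sum_(B : block v | I \subset B) F B = 0)%R.
  move=> leI; rewrite sumrB.
  have := balT _ _ leI erefl; rewrite !count_mset => /(congr1 Posz).
  by rewrite !(big_morph Posz PoszD (erefl _)) => ->; rewrite subrr.
(* Simplicity and disjointness force [F B] into {-1, 0, 1}, so its square is [T.1 B + T.2 B];
   balance at the empty set gives [T.1] and [T.2] equal sizes. *)
have sqrF : (\sum_(B : block v) F B ^+ 2 = (2 * vol T)%N%:Z)%R.
  have -> : 2 * vol T = \sum_(B : block v) (T.1 B + T.2 B).
    rewrite big_split mul2n -addnn /vol.
    have szT (A : {mset block v}%mset) : size A = \sum_B A B.
      by rewrite -count_predT count_mset.
    rewrite -!szT; congr (_ + _).
    have := balT 0 set0 (leq0n t) (cards0 _).
    have sub0 : (fun B : block v => set0 \subset B) =1 predT.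
      by move=> B; rewrite sub0set.
    by rewrite !(eq_count sub0) !count_predT.
  rewrite (big_morph Posz PoszD (erefl _)); apply: eq_bigr => B _.
  have [leT1 leT2] := simT B; rewrite /F.
  have : ~~ ((B \in T.1) && (B \in T.2)).
    by apply/negP => /andP[T1B]; rewrite (disjointFr disjT T1B).
  rewrite !in_mset.
  by case: (T.1 B) leT1 => [|[]] // _; case: (T.2 B) leT2 => [|[]].
rewrite -(sum_sqr_trace _ F J) in sqrF; last first.
  by move=> B B' /suppF TB /suppF TB'; apply: sepJ.
suff : ((2 ^ t)%N %| (2 * vol T)%N%:Z)%Z by rewrite dvdzE.
rewrite -sqrF; apply: (dvdz_sum_sqr _ _ J t) => // I.
rewrite upsum_trace => sum_neq0.
have IJ : I \subset J.
  apply: contraR sum_neq0 => IJ; rewrite big_pred0 // => B.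
  by rewrite subsetI (negPf IJ) andbF.
rewrite IJ ltnNge; apply: contra sum_neq0 => /sumF sumI0.
rewrite -[X in _ == X]sumI0; apply/eqP/eq_bigl => B.
by rewrite subsetI IJ andbT.
Qed.

Theorem theorem4p9 (v t : nat) (T : mset_pair v)
    (t_ge1 : 1 <= t) (T_trade : is_trade t T) (T_simple : is_simple T)
    (vol_gt : ((3%:R / 2%:R) * 2%:R ^+ t < (vol T)%:R :> rat)%R)
    (vol_lt : ((vol T)%:R < (5%:R / 2%:R) * 2%:R ^+ t :> rat)%R)
    (vol_neq : vol T <> 2 ^ t.+1) :
  t + 4 <= afrk T.
Proof.
rewrite leqNgt; apply/negP => afrk_lt; apply: vol_neq.
have /dvdnP[k def_vol] : 2 ^ t %| 2 * vol T by apply: dvdn_vol => //; lia.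
(* Doubling the rational bounds makes them integral; after cancelling [2 ^ t] they read 3 < [k] <
   5. *)
have vol_gt' : 3 * 2 ^ t < 2 * vol T.
  rewrite -(ltr_nat rat) !natrM natrX; lra.
have vol_lt' : 2 * vol T < 5 * 2 ^ t.
  rewrite -(ltr_nat rat) !natrM natrX; lra.
move: vol_gt' vol_lt'; rewrite def_vol !ltn_pmul2r ?expn_gt0 // => gt3 lt5.
have k4 : k = 4 by lia.
by move: def_vol; rewrite k4 expnS; lia.
Qed.
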